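(* Let $k$ be a field of characteristic zero. The variety of dual Leibniz algebras over $k$ is Shpekhtian, i.e. each of its subvarieties can be defined by a finite system of identities.
   Context: An algebra over a field $k$ is a $k$-vector space with a bilinear multiplication (not necessarily associative or unital). A dual Leibniz algebra (also called a Zinbiel algebra) over $k$ is an algebra $A$ over $k$ satisfying the identity $(xy)z=x(zy+yz)$ for all $x,y,z\in A$. A variety of algebras over $k$ is the class of all algebras over $k$ satisfying a given set of identities (nonassociative polynomials over $k$ without constant term, required to vanish under all substitutions of elements of the algebra). A subvariety of a variety is a variety contained in it. A variety is called Shpekhtian (Spechtian) if each of its subvarieties is defined by a finite system of identities. *)

(* Defs.v *)
From HB Require Import structures.
From mathcomp Require Import all_boot all_order all_algebra.
From mathcomp Require Import finmap.
From mathcomp Require Import monalg.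

Set Implicit Arguments.
Unset Strict Implicit.
Unset Printing Implicit Defensive.

Import GRing.Theory.
Local Open Scope ring_scope.

(* No associativity, commutativity or unit is required. *)
Record na_alg (k : fieldType) := NaAlg {
  na_alg_car :> lmodType k;
  na_alg_mul : {bilinear na_alg_car -> na_alg_car -> na_alg_car}
}.

(* Nonassociative monomials in the variables x_0, x_1, ...  There is no empty
   monomial, so linear combinations of these have no constant term. *)
Inductive na_mon : Type :=
| NVar of nat
| NMul of na_mon & na_mon.

Fixpoint na_mon_encode (m : na_mon) : GenTree.tree nat :=
  match m with
  | NVar i => GenTree.Leaf i
  | NMul m1 m2 => GenTree.Node 0 [:: na_mon_encode m1; na_mon_encode m2]
  end.

Fixpoint na_mon_decode (t : GenTree.tree nat) : na_mon :=
  match t with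
  | GenTree.Leaf i => NVar i
  | GenTree.Node _ [:: t1; t2] => NMul (na_mon_decode t1) (na_mon_decode t2)
  | _ => NVar 0
  end.

Lemma na_mon_encodeK : cancel na_mon_encode na_mon_decode.
Proof. by elim=> //= m1 -> m2 ->. Qed.

HB.instance Definition _ := Countable.copy na_mon (can_type na_mon_encodeK).

(* The underlying space of the free nonassociative algebra on x_0, x_1, ... *)
Notation na_poly k := {malg k[na_mon]}.

Section Varieties.
Variable k : fieldType.

Fixpoint na_mon_eval (A : na_alg k) (v : nat -> A) (m : na_mon) : A :=
  match m with
  | NVar i => v i
  | NMul m1 m2 => na_alg_mul A (na_mon_eval v m1) (na_mon_eval v m2)
  end.

Definition na_poly_eval (A : na_alg k) (v : nat -> A) (f : na_poly k) : A :=
  \sum_(m <- msupp f) f@_m *: na_mon_eval v m.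

Definition satisfies (A : na_alg k) (f : na_poly k) : Prop :=
  forall v : nat -> A, na_poly_eval v f = 0.

Definition alg_class := na_alg k -> Prop.

Definition defined_by (V : alg_class) (S : na_poly k -> Prop) : Prop :=
  forall A : na_alg k, V A <-> (forall f, S f -> satisfies A f).

Definition is_variety (V : alg_class) : Prop :=
  exists S : na_poly k -> Prop, defined_by V S.

Definition subvariety (W V : alg_class) : Prop :=
  is_variety W /\ (forall A : na_alg k, W A -> V A).

Definition finitely_based (V : alg_class) : Prop :=
  exists s : seq (na_poly k), defined_by V (fun f => f \in s).

Definition spechtian (V : alg_class) : Prop :=
  is_variety V /\ (forall W : alg_class, subvariety W V -> finitely_based W).

Definition dual_leibniz : alg_class := fun A =>
  forall x y z : A,
    na_alg_mul A (na_alg_mul A x y) z =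
    na_alg_mul A x (na_alg_mul A z y + na_alg_mul A y z).

End Varieties.

(* Main.v *)
Require Import Defs.
From Stdlib Require Import Classical_Prop.
From HB Require Import structures.
From mathcomp Require Import all_boot all_order all_algebra.
From mathcomp Require Import finmap monalg.
From mathcomp Require Import zify ring.

(** A subvariety W of the dual Leibniz algebras is either the whole variety,
    defined by the single dual Leibniz identity, or it is nilpotent; and a
    nilpotent variety is defined by finitely many identities.

    Normal forms.  The identity turns every monomial into a sum of right-normed
    words x1 (x2 (... xn)), the product of two words being given by shuffles
    ([mul_rword], [na_poly_eval_nf]).  If the normal form of each identity of W
    is zero, then W contains every dual Leibniz algebra.

    From an identity to nil index.  Otherwise some identity f of W has a nonzero
    normal form.  Inclusion and exclusion over sums of variables isolates in f
    a nonzero multilinear combination sum_u c_u u, with u running over the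
    orderings of d letters ([polarization]).  For the commutative associative
    product x * y = xy + yx put x^n = x * ... * x; then
    x^m x^n = m / (m + n) x^(m + n), as for t^m, t^n under the product
    (p, q) |-> int p' q.  Substituting x^(a l) for the letter l evaluates the
    word u to a scalar multiple of x^(sum of all a l), and the scalar is
    essentially the product of the inverses of the suffix sums of a along u, an
    iterated integral over a simplex.  These functions of a are linearly
    independent ([simplex_independent]): if the letter i comes first in some u
    with c_u <> 0, let a i grow; after multiplication by the total sum, words
    that start with i are constant and all the others tend to zero.  Hence
    x^n = 0 holds in W for some n ([identity_nil]), and linearization gives
    x1 * ... * xn = 0.

    From nil to nilpotent.  [nil_nilpotent] is an induction on n, in the spirit
    of Nagata and Higman.  A product of n - 1 elements of the square of A
    annihilates A, so by induction long words in the square are zero.  The law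
    x (y (z a)) = (xy) (za) - x ((zy) a) rewrites a long word in A into words
    with many letters from the square.

    Finite basis.  If all monomials of degree >= N vanish, inclusion and
    exclusion shows that an identity is equivalent to its restrictions to fewer
    than N variables ([satisfies_small_support]).  After renaming, these lie in
    the span of a finite list of monomials, whose subspaces are finitely
    generated ([supported_finite_basis]). *)

Set Implicit Arguments.
Unset Strict Implicit.
Unset Printing Implicit Defensive.

Import GRing.Theory.
Local Open Scope ring_scope.

Local Notation "x ** y" := (na_alg_mul _ x y) (at level 40, left associativity).

(** * Words and the symmetrized product *)

Section Words.
Variables (k : fieldType) (A : na_alg k).
Implicit Types (x y z : A) (s t : seq A).

Fixpoint rword s : A :=
  if s is x :: s' then (if s' is [::] then x else x ** rword s') else 0.

Lemma rword_cons x s : s != [::] -> rword (x :: s) = x ** rword s.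
Proof. by case: s. Qed.

Lemma rword_cat s t : t != [::] ->
  rword (s ++ t) = foldr (na_alg_mul A) (rword t) s.
Proof.
by move=> t0; elim: s => //= x s IHs; rewrite -IHs; case: s {IHs} => //=; case: t t0.
Qed.

End Words.

Section Zinbiel.
Variables (k : fieldType) (A : na_alg k).
Hypothesis zinA : dual_leibniz A.
Implicit Types (x y z : A) (s t : seq A).

Definition star x y := x ** y + y ** x.

(** The form in which the dual Leibniz identity is used throughout. *)
Lemma zin_mulA x y z : (x ** y) ** z = x ** star y z.
Proof. by rewrite zinA [z ** y + _]addrC. Qed.

Lemma starC x y : star x y = star y x.
Proof. exact: addrC. Qed.

(** Expanded by [zin_mulA], the triple product is symmetric in its three
    arguments; with commutativity this is associativity. *)
Lemma starA x y z : star (star x y) z = star x (star y z).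
Proof.
suff E a b c : star (star a b) c
    = a ** star b c + b ** star a c + c ** star a b.
  by rewrite E [RHS]starC E (starC y x) (starC z x) [RHS]addrC addrA.
by rewrite /star linearDl /= !zin_mulA.
Qed.

(** As [star] has no unit, the product of the empty list is the junk value 0 and
    the lemmas assume nonempty lists. *)
Fixpoint starprod s : A :=
  if s is x :: s' then (if s' is [::] then x else star x (starprod s')) else 0.

Lemma starprod_cons x s : s != [::] -> starprod (x :: s) = star x (starprod s).
Proof. by case: s. Qed.

Lemma starprod_cat s t : s != [::] -> t != [::] ->
  starprod (s ++ t) = star (starprod s) (starprod t).
Proof.
move=> + t0; elim: s => // x [|y s] IHs _.
  by rewrite cat1s starprod_cons.
by rewrite cat_cons starprod_cons // IHs // [starprod (x :: _)]starprod_cons // starA.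
Qed.

Lemma starprod_catCA r s t : starprod (r ++ s ++ t) = starprod (s ++ r ++ t).
Proof.
case: r s t => [|x r] [|y s] [|z t]; rewrite ?cats0 ?cat0s //.
  by rewrite !starprod_cat // starC.
by rewrite !starprod_cat // -!starA (starC (starprod (x :: r))).
Qed.

Lemma starprod_perm s t : perm_eq s t -> starprod s = starprod t.
Proof. exact: (catCA_perm_subst starprod_catCA). Qed.

(** A letter [y] with neighbours on both sides is absorbed by the left one or by
    the right one, and the neighbour becomes an element of the square of the
    algebra. *)
Lemma mul3_merge x y z a :
  x ** (y ** (z ** a)) = (x ** y) ** (z ** a) - x ** ((z ** y) ** a).
Proof.
rewrite !zin_mulA [in X in _ = X - _]/star linearDr zin_mulA starC.
by rewrite (starC y a) addrK.
Qed.

End Zinbiel.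

(** * Nil dual Leibniz algebras are nilpotent *)

Fixpoint every (T : Type) (P : T -> Prop) (s : seq T) : Prop :=
  if s is x :: s' then P x /\ every P s' else True.

Lemma every_cat T (P : T -> Prop) s t :
  every P s -> every P t -> every P (s ++ t).
Proof. by elim: s => //= x s IHs [Px /IHs Ps] /Ps. Qed.

Lemma every_rev T (P : T -> Prop) s : every P s -> every P (rev s).
Proof.
elim: s => //= x s IHs [Px Ps]; rewrite rev_cons -cats1.
by apply: every_cat; [exact: IHs | split].
Qed.

Lemma every_sub T (P Q : T -> Prop) s :
  (forall x, P x -> Q x) -> every P s -> every Q s.
Proof. by move=> PQ; elim: s => //= x s IHs [/PQ Qx /IHs]. Qed.

Section Nil.
Variables (k : fieldType) (A : na_alg k).
Hypothesis zinA : dual_leibniz A.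
Implicit Types (x y z : A) (s t : seq A) (B I : A -> Prop).

(** The induction on the nil index passes to the square of the algebra modulo its
    annihilator.  Predicates [B] (a subalgebra) and [I] (the elements regarded as
    zero) on one fixed algebra replace the successive subquotients, so that no
    quotient algebra is built. *)
Definition subalgebra B :=
  (forall x y, B x -> B y -> B (x + y)) /\ (forall x y, B x -> B y -> B (x ** y)).

Definition ideal_for B I :=
  (forall x y, I x -> I y -> I (x - y)) /\
  (forall b x, B b -> I x -> I (b ** x) /\ I (x ** b)).

Inductive square B : A -> Prop :=
| square_mul x y of B x & B y : square B (x ** y)
| square_add x y of square B x & square B y : square B (x + y).

Definition transporter B I x := forall b, B b -> I (b ** x) /\ I (x ** b).

Lemma square_sub B : subalgebra B -> forall x, square B x -> B x.
Proof.
by case=> BD BM x; elim=> [y z By Bz|y z _ By _ Bz]; [apply: BM | apply: BD].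
Qed.

Lemma square_subalgebra B : subalgebra B -> subalgebra (square B).
Proof.
move=> subB; split=> x y Sx Sy; first exact: square_add.
by apply: square_mul; apply: square_sub.
Qed.

Lemma idealD B I x y : ideal_for B I -> I x -> I y -> I (x + y).
Proof.
case=> IB _ Ix Iy; rewrite -[y]opprK; apply: (IB) => //.
by rewrite -sub0r; apply: (IB) => //; rewrite -(subrr x); apply: IB.
Qed.

Lemma transporter_ideal B I :
  subalgebra B -> ideal_for B I -> ideal_for (square B) (transporter B I).
Proof.
move=> subB [IB IM]; split=> [x y Tx Ty b Bb | c x /(square_sub subB) Bc Tx].
  have [[? ?] [? ?]] := (Tx b Bb, Ty b Bb).
  by rewrite linearBl linearBr; split; apply: (IB).
by have [? ?] := Tx c Bc; split=> b Bb; apply: IM.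
Qed.

Section Step.
Variables B I : A -> Prop.
Hypotheses (subB : subalgebra B) (idI : ideal_for B I).

(** The two sides are products of at least one element [c] of the square with
    others.  By [zin_mulA] the product splits, as for a derivation, into terms
    where some [c = a b] stands leftmost: [(a b) p = a (b * p)], and [b * p] has
    [n] factors. *)
Lemma starprod_square_mul n s t :
  (forall u, size u = n -> every B u -> I (starprod u)) ->
  s != [::] -> t != [::] -> (size s + size t)%N = n ->
  every (square B) s -> every B t -> I (starprod s ** starprod t).
Proof.
move=> nilI; elim: s t => // c s IHs t _ t0 sz [Sc Ss] Bt.
have BS := square_sub subB.
have Ic w : every B w -> w != [::] -> (size w).+1 = n -> I (c ** starprod w).
  move=> Bw w0 szw; elim: Sc => [a b Ba Bb | a b _ Ia _ Ib].
    rewrite zin_mulA //; apply: (proj1 (idI.2 _ _ Ba _)).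
    by rewrite -starprod_cons //; apply: nilI.
  by rewrite linearDl; apply: (idealD idI Ia Ib).
have [s0|s0] := eqVneq s [::].
  by rewrite s0 in sz *; apply: Ic => //; rewrite -sz.
rewrite starprod_cons // /star linearDl !zin_mulA //; apply: (idealD idI).
  rewrite -starprod_cat //; apply: Ic; last by rewrite size_cat.
    by apply: every_cat => //; apply: every_sub Ss.
  by case: (s) s0.
rewrite -starprod_cons //; apply: IHs => //.
  by rewrite -sz /= addnS addSn.
by split=> //; apply: BS.
Qed.

(** The step that lowers the nil index.  Write [p] for the product of [s]: [p b]
    lies in [I] by [starprod_square_mul], and [b p + p b] is a product of [n + 2]
    factors, so [b p] lies in [I] as well. *)
Lemma starprod_square_transporter n :
  (forall s, size s = n.+2 -> every B s -> I (starprod s)) ->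
  forall s, size s = n.+1 -> every (square B) s -> transporter B I (starprod s).
Proof.
move=> nilI s szs Ss b Bb.
have s0 : s != [::] by case: (s) szs.
have Isb : I (starprod s ** b).
  by apply: (starprod_square_mul (t := [:: b]) nilI); rewrite ?szs //= ?addn1.
split=> //; have -> : b ** starprod s = star b (starprod s) - starprod s ** b.
  by rewrite addrK.
apply: idI.1 => //; rewrite -starprod_cons //.
apply: nilI; rewrite /= ?szs //; split=> //.
by apply: every_sub Ss; apply: square_sub.
Qed.

(** The operators of left multiplication by the letters of [s], the head of [s]
    acting first: the list is a stack whose top is the innermost letter, the one
    that absorbs its right neighbour. *)
Let thread (s : seq A) (x : A) : A := foldl (fun b c => c ** b) x s.

Lemma threadB s x y : thread s (x - y) = thread s x - thread s y.
Proof. by elim: s x y => //= c s IHs x y; rewrite linearBr IHs. Qed.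

(** Each step consumes at most three letters of [z] and pushes one element of the
    square on the stack [cs]; when [m] of them are collected, the hypothesis on
    the square applies.  One letter of [z] must survive, for the innermost
    argument to lie in the square as well; whence the strict bound on [3 * j]. *)
Lemma merge_letters m j (cs z : seq A) (x t : A) :
  (forall s (u : A), size s = m -> every (square B) s -> square B u ->
     transporter B I (foldr (na_alg_mul A) u s)) ->
  (size cs + j = m)%N -> (3 * j < size z)%N ->
  B x -> every (square B) cs -> every B z -> B t ->
  I (x ** thread cs (foldr (na_alg_mul A) t z)).
Proof.
move=> nilB'; have [BD BM] := subB.
have Bfold (u : A) r : every B r -> B u -> B (foldr (na_alg_mul A) u r).
  by elim: r => //= y r IHr [By Br] Bu; apply: BM => //; apply: IHr.
elim: j cs x z => [|j IHj] cs x z szcs szz Bx Scs Bz Bt.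
  rewrite /thread -[cs]revK foldl_rev.
  apply: (proj1 (nilB' _ _ _ _ _ _ Bx)); first by rewrite size_rev -szcs addn0.
    exact: every_rev.
  case: z szz Bz => // y z _ [By Bz] /=; apply: square_mul => //; exact: Bfold.
case: z szz Bz => [|z1 [|z2 [|z3 z]]] /= szz; try lia.
case=> B1 [B2 [B3 Bz]]; set a := foldr _ t z.
have step c r : square B c -> every B r -> (3 * j < size r)%N ->
    I (x ** thread cs (c ** foldr (na_alg_mul A) t r)).
  move=> Sc Br szr; apply: (IHj (c :: cs)) => //; by rewrite -szcs addnS.
(* [z1 z2 z3] is [(z1 z2) z3 - z1 (z3 z2)]; in the second term [z1] is absorbed
   in turn, so that both terms gain an element of the square. *)
rewrite mul3_merge // threadB linearBr; apply: idI.1.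
  by apply: (step _ (z3 :: z)) => //=; [apply: square_mul | lia].
have Sq c d : B c -> B d -> square B (c ** d) by move=> ? ?; apply: square_mul.
(* The left neighbour of [z1] is the top of the stack, or [x] if it is empty. *)
case: cs szcs Scs step => [|c cs] szcs /= Scs step.
  rewrite mul3_merge //; apply: idI.1.
    apply: (IHj [:: z3 ** z2]) => //=; try lia; first exact: BM.
    by split=> //; apply: Sq.
  by apply: step; [apply: Sq => //; apply: BM | | lia].
case: Scs => Sc Scs; rewrite mul3_merge // threadB linearBr; apply: idI.1.
  have szcs' : (size [:: z3 ** z2, c ** z1 & cs] + j)%N = m.
    by rewrite -szcs /= addnS.
  apply: (IHj _ x z szcs'); rewrite //=; try lia.
  by split; [|split=> //]; apply: Sq => //; apply: square_sub.
by apply: step; [apply: Sq => //; apply: BM | | lia].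
Qed.

End Step.

Fixpoint nilpotency_bound n := if n is n'.+1 then (3 * nilpotency_bound n').+2 else 0%N.

(** The bound on the length satisfies [b 0 = 0] and [b (n + 1) = 3 (b n) + 2]: one
    leftmost letter and the [3 (b n) + 1] letters that [merge_letters] needs. *)
Theorem nil_nilpotent n B I : subalgebra B -> ideal_for B I ->
  (forall s, size s = n.+1 -> every B s -> I (starprod s)) ->
  forall s (t : A), size s = nilpotency_bound n -> every B s -> B t ->
  I (foldr (na_alg_mul A) t s).
Proof.
elim: n B I => [|n IHn] B I subB idI nilI s t szs Bs Bt.
  by case: s szs Bs => // _ _; apply: (nilI [:: t]).
case: s szs Bs => // x s /= [szs] [Bx Bs].
apply: (@merge_letters B I subB idI (nilpotency_bound n) (nilpotency_bound n) [::]) => //.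
  move=> r u szr Sr Su; apply: IHn Su => //.
  - exact: square_subalgebra.
  - exact: transporter_ideal.
  by move=> *; apply: starprod_square_transporter; eauto.
by rewrite szs.
Qed.

End Nil.

(** * Shuffles and normal forms *)

Section Shuffle.
Variable T : Type.
Implicit Types s t : seq T.

Fixpoint shuffle s : seq T -> seq (seq T) :=
  if s is x :: s' then
    fix shuffle_s t :=
      if t is y :: t' then
        [seq x :: u | u <- shuffle s' t] ++ [seq y :: u | u <- shuffle_s t']
      else [:: s]
  else fun t => [:: t].

Lemma shuffle_cons x y s t :
  shuffle (x :: s) (y :: t) =
  [seq x :: u | u <- shuffle s (y :: t)] ++ [seq y :: u | u <- shuffle (x :: s) t].
Proof. by []. Qed.

Lemma shuffles0 s : shuffle s [::] = [:: s]. Proof. by case: s. Qed.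

Lemma size_shuffle s t : all (fun u => size u == size s + size t)%N (shuffle s t).
Proof.
elim: s t => [|x s IHs] t; first by rewrite /= eqxx.
elim: t => [|y t IHt]; first by rewrite /= addn0 eqxx.
rewrite shuffle_cons all_cat !all_map; apply/andP; split.
  by apply: sub_all (IHs (y :: t)) => u /=; rewrite addSn eqSS.
by apply: sub_all IHt => u /=; rewrite !addnS eqSS.
Qed.

(** Shuffling is symmetric only up to reordering of the list of shuffles, which a
    sum does not see. *)
Lemma shuffleC (V : nmodType) (F : seq T -> V) s t :
  \sum_(u <- shuffle s t) F u = \sum_(u <- shuffle t s) F u.
Proof.
elim: s t F => [|x s IHs] t F; first by rewrite shuffles0.
elim: t F => [|y t IHt] F; first by rewrite shuffles0.
by rewrite !shuffle_cons !big_cat !big_map /= IHs IHt addrC.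
Qed.

End Shuffle.

Section ShuffleProduct.
Variables (k : fieldType) (A : na_alg k).
Hypothesis zinA : dual_leibniz A.

(** By [(x s) t = x (s * t)] and induction on the total length: the words of
    [s * t] start with the first letter of [s] or with that of [t], which is the
    recursion that defines shuffles. *)
Lemma mul_rword (T : Type) (v : T -> A) x s t : t <> [::] ->
  rword (map v (x :: s)) ** rword (map v t) =
  \sum_(u <- shuffle s t) rword (map v (x :: u)).
Proof.
have [n le_n] := ubnP (size s + size t); elim: n => // n IHn in x s t le_n *.
case: t le_n => // z t le_n _; case: s le_n => [|y s] le_n.
  by rewrite big_seq1.
rewrite shuffle_cons big_cat !big_map !map_cons rword_cons // -!map_cons zin_mulA //.
rewrite linearDr !IHn //; try by move: le_n => /=; lia.
by rewrite (shuffleC _ t) !linear_sumr.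
Qed.

End ShuffleProduct.

Section NormalForm.

Fixpoint normal_form (m : na_mon) : seq (seq nat) :=
  match m with
  | NVar i => [:: [:: i]]
  | NMul m1 m2 =>
    flatten [seq (if w is x :: s then [seq x :: u | u <- shuffle s w'] else [::])
            | w <- normal_form m1, w' <- normal_form m2]
  end.

Fixpoint na_deg (m : na_mon) : nat :=
  match m with NVar _ => 1 | NMul m1 m2 => na_deg m1 + na_deg m2 end.

Lemma na_deg_gt0 m : (0 < na_deg m)%N.
Proof. by elim: m => //= m1 d1 m2 d2; rewrite addn_gt0 d1. Qed.

Lemma size_normal_form m : all (fun w => size w == na_deg m) (normal_form m).
Proof.
elim: m => // m1 /allP IH1 m2 /allP IH2; apply/allP => u /flattenP[ws].
case/allpairsP=> -[w w'] /= [/IH1 + /IH2/eqP<- ->].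
case: w => //= x s /eqP<- /mapP[w'' w''in ->] /=.
by rewrite addSn eqSS; apply: (allP (size_shuffle s w')).
Qed.

Variables (k : fieldType) (A : na_alg k).
Hypothesis zinA : dual_leibniz A.

Lemma na_mon_eval_nf (v : nat -> A) m :
  na_mon_eval v m = \sum_(w <- normal_form m) rword (map v w).
Proof.
elim: m => [i|m1 IH1 m2 IH2] /=; first by rewrite big_seq1.
rewrite big_flatten big_allpairs_dep /= IH1 IH2 linear_sumlz /=.
rewrite big_seq [RHS]big_seq; apply: eq_bigr => w win.
rewrite linear_sumr big_seq [RHS]big_seq; apply: eq_bigr => w' w'in.
have := allP (size_normal_form m2) _ w'in; have := na_deg_gt0 m2.
have := allP (size_normal_form m1) _ win; have := na_deg_gt0 m1.
case: w win => [|x s] _; first by case: na_deg.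
case: w' {w'in} => [|y t]; first by case: (na_deg m2).
by move=> *; rewrite mul_rword // big_map.
Qed.

Definition nf_coef (f : na_poly k) (w : seq nat) : k :=
  \sum_(m <- msupp f) f@_m *+ count_mem w (normal_form m).

Definition nf_words (f : na_poly k) : seq (seq nat) :=
  undup (flatten [seq normal_form m | m <- msupp f]).

Lemma nf_coef_out f w : w \notin nf_words f -> nf_coef f w = 0.
Proof.
move=> wnin; rewrite /nf_coef big_seq big1 // => m msuppf.
have /count_memPn-> // : w \notin normal_form m.
apply: contra wnin => wm; rewrite mem_undup; apply/flattenP.
by exists (normal_form m) => //; apply: map_f.
Qed.

Lemma sum_count_mem (T : eqType) (V : nmodType) (F : T -> V) (s D : seq T) :
  uniq D -> {subset s <= D} ->
  \sum_(x <- s) F x = \sum_(x <- D) F x *+ count_mem x s.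
Proof.
move=> uD; elim: s => [|x s IHs] sD.
  by rewrite big_nil big1 // => x _; rewrite mulr0n.
rewrite big_cons IHs => [|y ys]; last by apply: sD; rewrite inE ys orbT.
under [RHS]eq_bigr do rewrite mulrnDr.
rewrite big_split /=; congr (_ + _).
rewrite (bigD1_seq x) ?sD ?mem_head //= eqxx mulr1n.
by rewrite big1 ?addr0 // => y; rewrite eq_sym => /negPf->; rewrite mulr0n.
Qed.

Lemma na_poly_eval_nf (v : nat -> A) f :
  na_poly_eval v f = \sum_(w <- nf_words f) nf_coef f w *: rword (map v w).
Proof.
under [RHS]eq_bigr do rewrite scaler_suml.
rewrite exchange_big /=; apply: eq_big_seq => m msuppf.
rewrite na_mon_eval_nf (@sum_count_mem _ _ _ _ (nf_words f)) ?undup_uniq //.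
  by rewrite scaler_sumr; apply: eq_bigr => w _; rewrite -scalerMnl scalerMnr.
move=> w wm; rewrite mem_undup; apply/flattenP.
by exists (normal_form m) => //; apply: map_f.
Qed.

End NormalForm.

(** * Polarization *)

(** Inclusion and exclusion on the interval from [U] to [J]: the sum expands the
    product over [i] of [- (i in J) + (i notin U)], whose factor at an element
    distinguishing [U] from [J] is zero. *)
Lemma alternating_sum (R : comNzRingType) (L : finType) (U J : {set L}) :
  \sum_(K : {set L} | (U \subset K) && (K \subset J)) (-1) ^+ #|K|
    = (U == J)%:R * (-1) ^+ #|J| :> R.
Proof.
pose F i : R := - (i \in J)%:R; pose G i : R := (i \notin U)%:R.
have termE (K : {set L}) : \prod_i (if i \in K then F i else G i)
    = if (U \subset K) && (K \subset J) then (-1) ^+ #|K| else 0 :> R.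
  rewrite /F /G; case: ifP => [/andP[/subsetP UK /subsetP KJ] | ].
    rewrite -prodr_const [RHS]big_mkcond; apply: eq_bigr => i _.
    case: ifP => [/KJ-> //|iK]; rewrite (contraFN (UK i)) ?iK //.
  move/negbT; rewrite negb_and => /orP[] /subsetPn[i iin inotin].
    by rewrite (bigD1 i) //= (negPf inotin) iin mul0r.
  by rewrite (bigD1 i) //= iin (negPf inotin) oppr0 mul0r.
have <- : \prod_i (F i + G i) = \sum_(K : {set L} | (U \subset K) && (K \subset J)) (-1) ^+ #|K|.
  rewrite bigA_distr [RHS]big_mkcond; apply: eq_bigr => K _; exact: termE.
rewrite /F /G {F G termE}.
have [<-|neqUJ] := eqVneq U J.
  rewrite mul1r -prodr_const [RHS]big_mkcond; apply: eq_bigr => i _.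
  by case: (i \in U); rewrite ?addr0 ?oppr0 ?add0r.
rewrite mul0r; have [i /eqP] : exists i, (i \in U) != (i \in J).
  apply/existsP; apply: contraNT neqUJ; rewrite negb_exists => /forallP eqUJ.
  by apply/eqP/setP=> i; apply/eqP; have := eqUJ i; rewrite negbK.
rewrite (bigD1 i) //=; case: (i \in U) (i \in J) => [] [] //.
  by rewrite oppr0 addr0 mul0r.
by rewrite addNr mul0r.
Qed.

Section Polarization.
Variables (k : fieldType) (A : na_alg k) (L : finType) (p : L -> nat).

Fixpoint lifts (w : seq nat) : seq (seq L) :=
  if w is i :: w' then
    [seq l :: u | l <- [seq l <- enum L | p l == i], u <- lifts w']
  else [:: [::]].

Lemma mem_lifts u w : (u \in lifts w) = (map p u == w).
Proof.
elim: w u => [|i w IHw] [|l u] //=; first by apply/negP => /allpairsP[[l u] []].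
rewrite eqseq_cons -IHw; apply/allpairsP/andP => [[[l' u'] /=]|[pl uw]].
  by rewrite mem_filter => -[/andP[? _] ? [-> ->]].
by exists (l, u); rewrite mem_filter pl mem_enum.
Qed.

Lemma lifts_uniq w : uniq (lifts w).
Proof.
elim: w => //= i w IHw; apply: allpairs_uniq => //.
  by rewrite filter_uniq ?enum_uniq.
by move=> [? ?] [? ?] _ _ [-> ->].
Qed.

Lemma rword_expand (y : L -> A) (K : {set L}) w :
  rword [seq \sum_(l in K | p l == i) y l | i <- w] =
  \sum_(u <- lifts w | [set x in u] \subset K) rword (map y u).
Proof.
have subE (l : L) u : ([set x in l :: u] \subset K) = (l \in K) && ([set x in u] \subset K).
  by rewrite set_cons subUset sub1set.
elim: w => [|i w IHw] /=.
  by rewrite big_cons big_nil; case: ifP; rewrite ?addr0.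
rewrite [RHS]big_mkcond big_allpairs_dep big_filter big_enum_cond /=.
have [->|w0] := eqVneq w [::].
  rewrite [LHS]big_mkcondl /=; apply: eq_bigr => l _.
  by rewrite big_seq1 subE (_ : [set x in [::]] \subset K) ?andbT //; apply/subsetP=> x; rewrite inE.
rewrite -[X in X = _]/(rword (_ :: map _ w)) rword_cons; last by case: (w) w0.
rewrite IHw linear_sumlz [LHS]big_mkcondl /=; apply: eq_bigr => l _.
rewrite linear_sumr -[RHS]big_mkcond; under [RHS]eq_bigl do rewrite subE.
case: (l \in K) => /=; last by rewrite big_pred0_eq.
rewrite big_seq_cond [RHS]big_seq_cond; apply: eq_bigr => u /andP[+ _]; rewrite mem_lifts.
by case: u => [|l' u] // /eqP ew; case: (w) ew w0.
Qed.

(** Substitute for each variable the sum of the labels over it that belong to [K],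
    and take the alternating sum over all [K]: what remains are the words that
    use every label.  Since no word with a nonzero coefficient is longer than the
    number of labels, each label occurs once.  A permutation of the
    labels lies over a single word, so the coefficients do not cancel. *)
Lemma polarization (c : seq nat -> k) (D : seq (seq nat)) :
    uniq D -> (forall w, w \notin D -> c w = 0) ->
    (forall w, c w != 0 -> (size w <= #|L|)%N) ->
    (forall v : nat -> A, \sum_(w <- D) c w *: rword (map v w) = 0) ->
  forall y : L -> A,
    \sum_(u <- permutations (enum L)) c (map p u) *: rword (map y u) = 0.
Proof.
move=> uD outD cdeg idA y.
pose R u := rword (map y u); pose sgn n : k := (-1) ^+ n.
have: \sum_(K : {set L}) sgn #|K| *:
    \sum_(w <- D) c w *: \sum_(u <- lifts w | [set x in u] \subset K) R u = 0.
  rewrite big1 // => K _; apply/eqP; rewrite scaler_eq0; apply/orP; right.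
  apply/eqP; rewrite -[RHS](idA (fun i => \sum_(l in K | p l == i) y l)).
  by apply: eq_bigr => w _; rewrite rword_expand.
under eq_bigr do rewrite scaler_sumr.
rewrite exchange_big /=.
(* The alternating sum over [K] keeps the words that use every letter of [L]. *)
have termE w : \sum_(K : {set L}) sgn #|K| *:
      (c w *: \sum_(u <- lifts w | [set x in u] \subset K) R u)
    = sgn #|L| *: \sum_(u <- permutations (enum L) | map p u == w) c w *: R u.
  have [-> | cw] := eqVneq (c w) 0.
    rewrite big1 => [|K _]; last by rewrite scale0r scaler0.
    by rewrite big1 ?scaler0 // => u _; rewrite scale0r.
  under eq_bigr do rewrite scaler_sumr scaler_sumr big_mkcond.
  rewrite exchange_big /= scaler_sumr.
  transitivity (\sum_(u <- lifts w | [set x in u] == setT) sgn #|L| *: (c w *: R u)).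
    rewrite [RHS]big_mkcond; apply: eq_bigr => u _.
    have altE : \sum_(K : {set L} | [set x in u] \subset K) sgn #|K|
        = ([set x in u] == setT)%:R * sgn #|L|.
      rewrite -[in RHS]cardsT -alternating_sum.
      by apply: eq_bigl => K; rewrite subsetT andbT.
    transitivity (\sum_(K : {set L} | [set x in u] \subset K) sgn #|K| *: (c w *: R u)).
      by rewrite [RHS]big_mkcond; apply: eq_bigr => K _; case: ifP; rewrite ?scaler0.
    by rewrite -scaler_suml altE; case: eqP; rewrite ?mul1r // mul0r scale0r.
  rewrite -[LHS]big_filter -[RHS]big_filter; apply: perm_big; apply: uniq_perm.
  - by rewrite filter_uniq ?lifts_uniq.
  - by rewrite filter_uniq ?permutations_uniq.
  move=> u; rewrite !mem_filter mem_permutations mem_lifts andbC.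
  have [puw|//] := eqVneq; rewrite /= -puw in cw *.
  have szu := cdeg _ cw; rewrite size_map in szu.
  apply/eqP/idP => [uT | /perm_mem uT]; last first.
    by apply/setP=> x; rewrite !inE uT mem_enum.
  have su : {subset enum L <= u} by move=> x _; have := in_setT x; rewrite -uT inE.
  rewrite cardE in szu; have [_ eqm] := uniq_min_size (enum_uniq L) su szu.
  by rewrite perm_sym uniq_perm ?enum_uniq // (leq_size_uniq (enum_uniq L) su szu).
under eq_bigr do rewrite termE; rewrite -scaler_sumr => /eqP.
rewrite scaler_eq0 signr_eq0 /= => /eqP sum0; rewrite -[RHS]sum0 {sum0}.
under [RHS]eq_bigr do rewrite big_mkcond.
rewrite exchange_big /=; apply: eq_bigr => u _; rewrite -big_mkcond /=.
have [uD'|uD'] := boolP (map p u \in D); last first.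
  rewrite outD // scale0r big1_seq // => w /andP[/eqP<-]; by rewrite (negPf uD').
rewrite (big_rem _ uD') /= eqxx big1_seq ?addr0 // => w /andP[/eqP<-].
by rewrite mem_rem_uniqF.
Qed.

End Polarization.

(** * Linear independence of simplex integrals *)

Section Independence.
Variable k : fieldType.
Hypothesis k0 : [pchar k] =i pred0.

Lemma char0_natr_eq0 n : (n%:R == 0 :> k) = (n == 0)%N.
Proof. exact: ((pcharf0P k).1 k0). Qed.

(** Rational functions without natural poles whose numerator has smaller degree
    than the denominator: the algebraic substitute, over any field of
    characteristic zero, for functions that tend to zero at infinity. *)
Definition proper_fraction (h : nat -> k) := exists P Q : {poly k},
  [/\ (size P < size Q)%N, forall n, Q.[n%:R] != 0 & forall n, h n = P.[n%:R] / Q.[n%:R]].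

Lemma eq_proper_fraction g h : g =1 h -> proper_fraction g -> proper_fraction h.
Proof. by move=> eqgh [P [Q [? ? gE]]]; exists P, Q; split=> // n; rewrite -eqgh. Qed.

Lemma proper_fraction0 : proper_fraction (fun=> 0).
Proof.
exists 0, 1; split=> [|n|n]; rewrite ?size_poly0 ?size_poly1 ?hornerC ?oner_neq0 //.
by rewrite mul0r.
Qed.

Lemma proper_fractionD g h : proper_fraction g -> proper_fraction h ->
  proper_fraction (fun n => g n + h n).
Proof.
case=> [P1 [Q1 [lt1 nz1 gE]]] [P2 [Q2 [lt2 nz2 hE]]].
exists (P1 * Q2 + P2 * Q1), (Q1 * Q2); split=> [|n|n]; last 2 first.
- by rewrite hornerM mulf_neq0.
- by rewrite gE hE hornerD !hornerM; field; rewrite nz1 nz2.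
have Q1n0 : Q1 != 0 by rewrite -size_poly_gt0; lia.
have Q2n0 : Q2 != 0 by rewrite -size_poly_gt0; lia.
rewrite size_mul //; apply: leq_ltn_trans (size_polyD _ _) _; rewrite gtn_max.
by apply/andP; split; apply: leq_ltn_trans (size_polyMleq _ _) _;
  move: lt1 lt2; move: (size P1) (size P2) (size Q1) (size Q2) => *; lia.
Qed.

Lemma proper_fractionZ c h : proper_fraction h -> proper_fraction (fun n => c * h n).
Proof.
case=> [P [Q [lt nz hE]]]; exists (c *: P), Q; split=> // [|n].
  exact: leq_ltn_trans (size_scale_leq _ _) lt.
by rewrite hE hornerZ mulrA.
Qed.

Lemma proper_fraction_sum (I : eqType) (r : seq I) (Q : pred I) (F : I -> nat -> k) :
  (forall i, i \in r -> Q i -> proper_fraction (F i)) ->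
  proper_fraction (fun n => \sum_(i <- r | Q i) F i n).
Proof.
elim: r => [|i r IHr] Fr.
  by apply: eq_proper_fraction proper_fraction0 => n; rewrite big_nil.
have Fr' : proper_fraction (fun n => \sum_(i <- r | Q i) F i n).
  by apply: IHr => j jr; apply: Fr; rewrite inE jr orbT.
have [Qi|nQi] := boolP (Q i).
  have := proper_fractionD (Fr i (mem_head i r) Qi) Fr'.
  by apply: eq_proper_fraction => n; rewrite big_cons Qi.
by apply: eq_proper_fraction Fr' => n; rewrite big_cons (negPf nQi).
Qed.

Lemma shift_neq0 b n : ('X + b.+1%:R%:P : {poly k}).[n%:R] != 0.
Proof. by rewrite hornerD hornerX hornerC -natrD addnS char0_natr_eq0. Qed.

Lemma proper_fraction_inv c b : proper_fraction (fun n => (n + b.+1)%:R^-1 * c).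
Proof.
exists c%:P, ('X + b.+1%:R%:P); split=> [|n|n]; last 2 first.
- exact: shift_neq0.
- by rewrite hornerD hornerX !hornerC natrD mulrC.
by rewrite size_XaddC size_polyC; case: (c != 0).
Qed.

Lemma proper_fraction_div h b : proper_fraction h ->
  proper_fraction (fun n => (n + b.+1)%:R^-1 * h n).
Proof.
case=> [P [Q [lt nz hE]]]; exists P, (('X + b.+1%:R%:P) * Q); split=> [|n|n].
- have Q0 : Q != 0 by rewrite -size_poly_gt0 (leq_ltn_trans _ lt).
  by rewrite size_mul // ?(monic_neq0 (monicXaddC _)) // size_XaddC /= ltnW.
- by rewrite hornerM mulf_neq0 ?shift_neq0.
by rewrite hE hornerM invfM hornerD hornerX hornerC natrD; ring.
Qed.

Lemma proper_fraction_nonconst c h : c != 0 -> proper_fraction h ->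
  exists n, c + h n != 0.
Proof.
move=> c0 [P [Q [lt nz hE]]].
have szQ : size (c *: Q + P) = size Q.
  by rewrite size_polyDl size_scale.
have f0 : c *: Q + P != 0 by rewrite -size_poly_gt0 szQ; lia.
pose rs : seq k := [seq n%:R | n <- iota 0 (size Q)].
have [/(max_poly_roots f0)|/allPn[_ /mapP[n _ ->] nroot]] := boolP (all (root (c *: Q + P)) rs).
  rewrite szQ size_map size_iota ltnn => /(_ _)/negP[] //.
  rewrite map_inj_in_uniq ?iota_uniq // => i j _ _ /eqP.
  wlog le_ij : i j / (i <= j)%N => [hw|].
    by case/orP: (leq_total i j) => /hw // + eqij => -> //; rewrite eq_sym.
  rewrite eq_sym -subr_eq0 -natrB // char0_natr_eq0 subn_eq0 => le_ji.
  by apply/eqP; rewrite eqn_leq le_ij.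
exists n; apply: contra nroot => /eqP eq0; rewrite /root hornerD hornerZ.
by rewrite -[P.[_]](divfK (nz n)) -hE -mulrDl eq0 mul0r.
Qed.

Variable T : eqType.
Implicit Types (a : T -> nat) (s u : seq T).

(** Up to the factor [prod_x a x], the coefficient of [t^(sum a)] in the iterated
    integral over the simplex of the derivatives of [t^(a x)], with [x] running
    along [u]. *)
Fixpoint simplex_integral a u : k :=
  if u is x :: u' then (\sum_(y <- u) a y)%N%:R^-1 * simplex_integral a u' else 1.

Definition scaled_weight a (i : T) (n : nat) : T -> nat :=
  fun x => if x == i then n.+1 else a x.

Lemma simplex_scaled_notin a i n u : i \notin u ->
  simplex_integral (scaled_weight a i n) u = simplex_integral a u.
Proof.
elim: u => // x u IHu; rewrite inE negb_or => /andP[nix niu] /=; rewrite IHu //.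
congr (_%:R^-1 * _); apply: eq_big_seq => y; rewrite /scaled_weight => yin.
by case: eqP => // yi; move: yin; rewrite yi inE (negPf nix) (negPf niu).
Qed.

Lemma sum_scaled a i u : uniq u -> i \in u ->
  exists b, forall n, (\sum_(x <- u) scaled_weight a i n x = n + b.+1)%N.
Proof.
move=> uu iu; exists (\sum_(x <- rem i u) a x)%N => n.
rewrite (big_rem i iu) /= {1}/scaled_weight eqxx addSnnS; congr (_ + _.+1)%N.
apply: eq_big_seq => x; rewrite /scaled_weight.
by case: eqP => // ->; rewrite mem_rem_uniqF.
Qed.

Lemma simplex_scaled_in a i u : uniq u -> i \in u ->
  proper_fraction (fun n => simplex_integral (scaled_weight a i n) u).
Proof.
elim: u => // x u IHu uxu iu; have [b bE] := sum_scaled a uxu iu.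
have /= /andP[xu uu] := uxu.
apply: (@eq_proper_fraction (fun n => (n + b.+1)%:R^-1
                              * simplex_integral (scaled_weight a i n) u)).
  by move=> n; rewrite -bE.
move: iu; rewrite inE => /predU1P[ix|iu]; last exact/proper_fraction_div/IHu.
apply: eq_proper_fraction (proper_fraction_inv (simplex_integral a u) b) => n.
by rewrite simplex_scaled_notin // ix.
Qed.

(** Induction on the number of letters, with the growing letter [i] chosen as the
    first letter of a word that has a nonzero coefficient.  Choosing it first is
    what makes the leading term an instance of the same statement for the
    remaining letters. *)
Theorem simplex_independent (c : seq T -> k) s : uniq s ->
  (exists2 u, u \in permutations s & c u != 0) ->
  exists2 a, forall x, (0 < a x)%N &
    \sum_(u <- permutations s) c u * simplex_integral a u != 0.
Proof.
have [n sz_s] := ubnP (size s); elim: n => // m IHm in s c sz_s *.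
move=> us [u0 u0s c0]; case: u0 u0s c0 => [|i t] /=.
  rewrite mem_permutations => /perm_size/esym/size0nil-> c0.
  by exists (fun=> 1%N) => //; rewrite big_seq1 mulr1.
rewrite mem_permutations => its cit.
have iin : i \in s by rewrite -(perm_mem its) mem_head.
have szs : (0 < size s)%N by case: (s) iin.
have [|||a a0 nz] := IHm (rem i s) (fun u => c (i :: u)).
- by rewrite size_rem // -ltnS prednK.
- exact: rem_uniq.
- exists t => //; rewrite mem_permutations -(perm_cons i).
  exact: perm_trans its (perm_to_rem iin).
pose w := scaled_weight a i; have [b bE] := sum_scaled a us iin.
pose part j n := \sum_(t <- permutations (rem j s)) c (j :: t) * simplex_integral (w n) t.
have part_i n : part i n
    = \sum_(t <- permutations (rem i s)) c (i :: t) * simplex_integral a t.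
  apply: eq_big_seq => r; rewrite mem_permutations => rs.
  by rewrite /w simplex_scaled_notin // (perm_mem rs) mem_rem_uniqF.
(* Multiplied by the total sum, the words that start with [i] no longer depend
   on the weight of [i], and the others are proper fractions in it. *)
have partE n : \sum_(u <- permutations s) c u * simplex_integral (w n) u
    = (n + b.+1)%:R^-1 * (part i 0 + \sum_(j <- s | j != i) part j n).
  rewrite (perm_big _ (permutationsE szs)) /= undup_id // big_allpairs_dep /=.
  transitivity (\sum_(j <- s) (n + b.+1)%:R^-1 * part j n).
    apply: eq_big_seq => j js; rewrite mulr_sumr.
    apply: eq_big_seq => r; rewrite mem_permutations -(perm_cons j) => jrs.
    rewrite -bE /= (perm_big s) /=; first by rewrite mulrCA.
    by rewrite (permPl jrs) perm_sym perm_to_rem.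
  by rewrite -mulr_sumr (bigD1_seq i) //= !part_i.
have [||n0 nz0] := @proper_fraction_nonconst (part i 0) (fun n => \sum_(j <- s | j != i) part j n).
- by rewrite part_i.
- apply: proper_fraction_sum => j js ji; apply: proper_fraction_sum => r rs _.
  apply/proper_fractionZ/simplex_scaled_in.
    by rewrite (perm_uniq (s2 := rem j s)) ?rem_uniq // -mem_permutations.
  rewrite (perm_mem (s2 := rem j s)) -?mem_permutations //.
  by rewrite mem_rem_uniq // inE eq_sym ji.
exists (w n0) => [x|]; first by rewrite /w /scaled_weight; case: eqP.
by rewrite partE mulf_neq0 // invr_eq0 addnS char0_natr_eq0.
Qed.

End Independence.

(** * Nontrivial identities bound the nil index *)

Section Powers.
Variables (k : fieldType) (A : na_alg k).
Hypotheses (k0 : [pchar k] =i pred0) (zinA : dual_leibniz A).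

Definition starpow (x : A) n := starprod (nseq n x).

Lemma starpowS x n : starpow x n.+2 = star x (starpow x n.+1).
Proof. by []. Qed.

Lemma starpowD x m n : (0 < m)%N -> (0 < n)%N ->
  starpow x (m + n) = star (starpow x m) (starpow x n).
Proof. by case: m n => [|m] [|n] // _ _; rewrite /starpow nseqD starprod_cat. Qed.

(** By induction and [zin_mulA],
    [x^(n+1) x = (n+1) (x x^n) x = (n+1) x (x^n * x) = (n+1) x x^(n+1)]. *)
Lemma starpow_mul x n : starpow x n.+2 = (x ** starpow x n.+1) *+ n.+2.
Proof.
elim: n => [|n IHn] //; rewrite starpowS /star {2}IHn -[LHS]/(_ + _).
have -> : (x ** starpow x n.+1) *+ n.+2 ** x = ((x ** starpow x n.+1) ** x) *+ n.+2.
  exact: linearMnl.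
by rewrite zin_mulA // starC -starpowS [RHS]mulrS.
Qed.

(** The rule for [t^m] and [t^n] under [(p, q) |-> int p' q], cleared of
    denominators: [x^m = m x x^(m-1)] by [starpow_mul], and
    [(x x^(m-1)) x^n = x (x^(m-1) * x^n)]. *)
Lemma starpow_mulE x m n : (0 < m)%N -> (0 < n)%N ->
  (starpow x m ** starpow x n) *+ (m + n) = starpow x (m + n) *+ m.
Proof.
case: m n => [|m] [|n] // _ _; rewrite addSn addnS starpow_mul.
case: m => [|m]; first by rewrite mulr1n add0n.
rewrite {1}starpow_mul linearMnl zin_mulA // -starpowD // addSnnS.
by rewrite -addSnnS -addnS -addSnnS -!mulrnA mulnC.
Qed.

Lemma rword_starpow x (T : eqType) (a : T -> nat) u : (forall l, 0 < a l)%N -> u != [::] ->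
  rword [seq starpow x (a l) | l <- u] =
  ((\prod_(l <- u) a l)%N%:R * simplex_integral k a u) *: starpow x (\sum_(l <- u) a l)%N.
Proof.
move=> a0; elim: u => // l u IHu _.
have al0 := a0 l; have nz n : (0 < n)%N -> n%:R != 0 :> k.
  by rewrite char0_natr_eq0 // -lt0n.
have [->|u0] := eqVneq u [::].
  by rewrite /= !big_seq1 mulr1 divff ?scale1r ?nz.
rewrite map_cons rword_cons; last by case: (u) u0.
rewrite IHu // !big_cons linearZr_LR /= big_cons; set S := (\sum_(l <- u) a l)%N.
have S0 : (0 < S)%N by case: (u) u0 @S => //= y r _; rewrite big_cons addn_gt0 a0.
have: (starpow x (a l) ** starpow x S) *+ (a l + S) = starpow x (a l + S) *+ a l.
  exact: starpow_mulE.
rewrite -!scaler_nat => /(congr1 (fun y => (a l + S)%N%:R^-1 *: y)).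
rewrite !scalerA mulVf ?nz ?addn_gt0 ?al0 // scale1r => ->; rewrite scalerA.
by congr (_ *: _); rewrite natrM; ring.
Qed.

End Powers.

Section StarAlgebra.
Variables (k : fieldType) (A : na_alg k).

Lemma star_is_bilinear : bilinear_for *:%R *:%R (@star k A).
Proof.
split=> [z c x y|z c x y]; rewrite /star.
  by rewrite linearPl linearPr /= scalerDr addrACA.
by rewrite linearPl linearPr /= scalerDr addrACA.
Qed.

HB.instance Definition _ :=
  bilinear_isBilinear.Build k A A A *:%R *:%R (@star k A) star_is_bilinear.

(** Polarization holds for any bilinear product; it is also applied to this one. *)
Definition star_alg : na_alg k := NaAlg (@star k A).

End StarAlgebra.

Section NilIdentity.
Variable k : fieldType.
Hypothesis k0 : [pchar k] =i pred0.

(** Polarize the word of [n] equal letters in [star_alg]: as [star] is commutative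
    and associative, all [n!] terms are equal. *)
Lemma starprod_linearize (A : na_alg k) (zinA : dual_leibniz A) n :
  (forall x : A, starpow x n = 0) -> forall s : seq A, size s = n -> starprod s = 0.
Proof.
move=> nilA s szs.
pose c (w : seq nat) : k := (w == nseq n 0%N)%:R.
have outc w : w \notin [:: nseq n 0%N] -> c w = 0.
  by rewrite inE /c; case: eqP.
have degc w : c w != 0 -> (size w <= #|'I_n|)%N.
  by rewrite /c; case: (w =P nseq n 0%N) => [->|]; rewrite ?eqxx // size_nseq card_ord.
have starE (t : seq A) : @rword k (star_alg A) t = starprod t.
  by elim: t => //= x t ->; case: t.
have idc (v : nat -> star_alg A) : \sum_(w <- [:: nseq n 0%N]) c w *: rword (map v w) = 0.
  by rewrite big_seq1 starE map_nseq [starprod _]nilA scaler0.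
pose y (i : 'I_n) : star_alg A := nth 0 s i.
have := polarization (fun=> 0%N) (isT : uniq [:: nseq n 0%N]) outc degc idc y.
have ys : map y (enum 'I_n) = s.
  rewrite -[RHS](mkseq_nth (0 : A)) szs /mkseq -val_enum_ord -map_comp.
  exact: eq_map.
rewrite (eq_big_seq (fun=> starprod s)) => [|u]; last first.
  rewrite mem_permutations => us; rewrite starE /c.
  have -> : [seq 0%N | _ <- u] = nseq n 0%N.
    by rewrite -[in RHS](size_enum_ord n) -(perm_size us); elim: (u) => //= _ r ->.
  by rewrite eqxx scale1r -[in RHS]ys; apply: starprod_perm => //; apply: perm_map.
rewrite big_const_seq count_predT iter_addr_0 size_permutations ?enum_uniq //.
rewrite -scaler_nat => /eqP; rewrite scaler_eq0 char0_natr_eq0 //.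
by rewrite -leqn0 leqNgt fact_gt0 => /eqP.
Qed.

(** The longest words of the normal form are polarized, which does without the
    separation of [f] into homogeneous components. *)
Theorem identity_nil (f : na_poly k) w0 : nf_coef f w0 != 0 ->
  exists n, forall (A : na_alg k) (zinA : dual_leibniz A), satisfies A f ->
    forall x : A, starpow x n.+1 = 0.
Proof.
move=> fw0.
have [d dmax] : exists d, forall w, nf_coef f w != 0 -> (size w <= d)%N.
  exists (\max_(w <- nf_words f) size w) => w fw; apply: leq_bigmax_seq => //.
  by apply: contraNT fw => /nf_coef_out->.
have [w1 fw1 w1max] : exists2 w1, nf_coef f w1 != 0 &
    forall w, nf_coef f w != 0 -> (size w <= size w1)%N.
  have exP : exists n, has (fun w => (nf_coef f w != 0) && (size w == n)) (nf_words f).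
    exists (size w0); apply/hasP; exists w0; rewrite ?fw0 ?eqxx //.
    by apply: contraNT fw0 => /nf_coef_out->.
  have ubP n : has (fun w => (nf_coef f w != 0) && (size w == n)) (nf_words f) -> (n <= d)%N.
    by case/hasP=> w _ /andP[/dmax + /eqP<-].
  case: (ex_maxnP exP ubP) => n /hasP[w1 _ /andP[fw1 /eqP<-]] nmax.
  exists w1 => // w fw; apply: nmax; apply/hasP; exists w; rewrite ?fw ?eqxx //.
  by apply: contraNT fw => /nf_coef_out->.
pose L : finType := 'I_(size w1); pose p (l : L) := nth 0%N w1 l.
have pw1 : map p (enum L) = w1.
  rewrite -[RHS](mkseq_nth 0%N) /mkseq -val_enum_ord -map_comp; exact: eq_map.
have w1_0 : w1 != [::].
  apply: contraNneq fw1 => ->; apply/eqP/nf_coef_out; rewrite mem_undup.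
  apply/flattenP=> -[ws /mapP[m _ ->]] /(allP (size_normal_form m))/=.
  by rewrite eq_sym (gtn_eqF (na_deg_gt0 m)).
have [|a a0 nz] := simplex_independent k0 (c := fun u => nf_coef f (map p u)) (enum_uniq L).
  by exists (enum L); rewrite ?mem_permutations // pw1.
(* The letters are replaced by powers of one element; only the total degree [N]
   matters for the result. *)
set N := (\sum_(l <- enum L) a l)%N; exists N.-1 => A zinA Af x.
have N0 : (0 < N)%N.
  rewrite /N; case: (enum L) (pw1) => [e|l s _]; first by rewrite -e in w1_0.
  by rewrite big_cons addn_gt0 a0.
rewrite prednK //; pose y (l : L) := starpow x (a l).
have sum0 : \sum_(u <- permutations (enum L))
    nf_coef f (map p u) *: rword (map y u) = 0.
  apply: (@polarization k A L p (nf_coef f) (nf_words f)); rewrite ?undup_uniq // ?card_ord //.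
    exact: nf_coef_out.
  by move=> v; rewrite -na_poly_eval_nf //; apply: Af.
have {sum0} : (\prod_(l <- enum L) a l)%N%:R *: ((\sum_(u <- permutations (enum L))
    nf_coef f (map p u) * simplex_integral k a u) *: starpow x N) = 0.
  rewrite -[RHS]sum0 scaler_suml scaler_sumr; apply: eq_big_seq => u.
  rewrite mem_permutations => uL; rewrite rword_starpow //; last first.
    by rewrite -size_eq0 (perm_size uL) size_enum_ord size_eq0.
  rewrite (perm_big _ uL) [in RHS](perm_big _ uL) /= !scalerA.
  by congr (_ *: _); ring.
move=> /eqP; rewrite !scaler_eq0 (negPf nz) /= char0_natr_eq0 //.
rewrite eqn0Ngt prodn_gt0 //= => /eqP //.
Qed.

End NilIdentity.

(** * Evaluation and supports of identities *)

Section Evaluation.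
Variables (k : fieldType) (A : na_alg k).
Implicit Types (f g : na_poly k) (v : nat -> A).

Lemma na_poly_evalEw v f (D : {fset na_mon}) : (msupp f `<=` D)%fset ->
  na_poly_eval v f = \sum_(m <- D) f@_m *: na_mon_eval v m.
Proof.
move=> fD; rewrite /na_poly_eval (big_fset_incl _ fD) // => m _.
by rewrite -mcoeff_eq0 => /eqP->; rewrite scale0r.
Qed.

Lemma na_poly_evalD v f g :
  na_poly_eval v (f + g) = na_poly_eval v f + na_poly_eval v g.
Proof.
rewrite (na_poly_evalEw _ (msuppD_le f g)).
rewrite (na_poly_evalEw _ (fsubsetUl (msupp f) (msupp g))).
rewrite (na_poly_evalEw _ (fsubsetUr (msupp f) (msupp g))).
by rewrite -big_split; apply: eq_bigr => m _; rewrite mcoeffD scalerDl.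
Qed.

Lemma na_poly_evalZ v c f : na_poly_eval v (c *: f) = c *: na_poly_eval v f.
Proof.
rewrite (na_poly_evalEw _ (msuppZ_le c f)) scaler_sumr.
by apply: eq_bigr => m _; rewrite mcoeffZ scalerA.
Qed.

Lemma na_poly_evalU v c m : na_poly_eval v << c *g m >> = c *: na_mon_eval v m.
Proof.
by rewrite (na_poly_evalEw _ msuppU_le) big_seq_fset1 mcoeffUU.
Qed.

Lemma na_poly_eval0 v : na_poly_eval v 0 = 0.
Proof. by rewrite /na_poly_eval msupp0 big_seq_fset0. Qed.

Lemma na_poly_eval_sum v (I : Type) (r : seq I) (P : pred I) (F : I -> na_poly k) :
  na_poly_eval v (\sum_(i <- r | P i) F i) = \sum_(i <- r | P i) na_poly_eval v (F i).
Proof. exact: (big_morph _ (na_poly_evalD v) (na_poly_eval0 v)). Qed.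

End Evaluation.

Section Identities.
Variable k : fieldType.
Implicit Types (A : na_alg k) (f g : na_poly k).

Definition dual_leibniz_poly : na_poly k :=
  << NMul (NMul (NVar 0) (NVar 1)) (NVar 2) >>
  - (<< NMul (NVar 0) (NMul (NVar 2) (NVar 1)) >>
     + << NMul (NVar 0) (NMul (NVar 1) (NVar 2)) >>).

Lemma dual_leibniz_polyP A : dual_leibniz A <-> satisfies A dual_leibniz_poly.
Proof.
have evE v : na_poly_eval v dual_leibniz_poly
    = (v 0%N ** v 1%N) ** v 2 - v 0%N ** (v 2 ** v 1%N + v 1%N ** v 2).
  rewrite /dual_leibniz_poly -scaleN1r !(na_poly_evalD, na_poly_evalZ, na_poly_evalU).
  by rewrite !scale1r scaleN1r linearDr.
split=> [zinA v | Af x y z]; first by rewrite evE zinA subrr.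
have := Af (fun i => nth 0 [:: x; y; z] i).
by rewrite evE => /eqP; rewrite subr_eq0 => /eqP.
Qed.

(** As [t] is not counted, the words of length [n + 1] vanish. *)
Definition nilpotent_at A n :=
  forall s (t : A), size s = n -> foldr (na_alg_mul A) t s = 0.

Definition long_word n : na_mon :=
  foldr (fun i => NMul (NVar i)) (NVar n) (iota 0 n).

Lemma nilpotent_atP A n : nilpotent_at A n <-> satisfies A << long_word n >>.
Proof.
have evE v : na_poly_eval v << long_word n >>
    = foldr (na_alg_mul A) (v n) (map v (iota 0 n)).
  rewrite na_poly_evalU scale1r /long_word.
  by elim: (iota 0 n) => //= i s ->.
split=> [nilA v | nilA s t szs]; first by rewrite evE nilA // size_map size_iota.
have := nilA (fun i => nth t s i); rewrite evE nth_default ?szs //.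
by rewrite -szs -/(mkseq _ _) mkseq_nth.
Qed.

Lemma nilpotent_na_mon_eval A n : dual_leibniz A -> nilpotent_at A n ->
  forall m (v : nat -> A), (n < na_deg m)%N -> na_mon_eval v m = 0.
Proof.
move=> zinA nilA m v degm; rewrite na_mon_eval_nf // big_seq big1 // => w.
move=> /(allP (size_normal_form m))/eqP szw.
have: (n < size (map v w))%N by rewrite size_map szw.
elim/last_ind: (map v w) => // s t _; rewrite size_rcons ltnS => len.
rewrite -cats1 rword_cat //= -(cat_take_drop (size s - n) s) foldr_cat.
rewrite [foldr _ _ (drop _ _)]nilA ?size_drop ?subKn //.
by elim: (take _ _) => //= x r ->; rewrite linear0r.
Qed.

Fixpoint mon_vars (m : na_mon) : seq nat :=
  match m with NVar i => [:: i] | NMul m1 m2 => mon_vars m1 ++ mon_vars m2 end.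

Lemma size_mon_vars m : size (mon_vars m) = na_deg m.
Proof. by elim: m => //= m1 <- m2 <-; rewrite size_cat. Qed.

Lemma eq_na_mon_eval A (v w : nat -> A) m :
  {in mon_vars m, v =1 w} -> na_mon_eval v m = na_mon_eval w m.
Proof.
elim: m => [i|m1 IH1 m2 IH2] /= vw; first by apply: vw; rewrite inE.
by rewrite IH1 ?IH2 // => i im; apply: vw; rewrite mem_cat im ?orbT.
Qed.

Lemma na_mon_eval_eq0 A (v : nat -> A) i m :
  i \in mon_vars m -> v i = 0 -> na_mon_eval v m = 0.
Proof.
move=> + vi0; elim: m => [j|m1 IH1 m2 IH2] /=; first by rewrite inE => /eqP<-.
by rewrite mem_cat => /orP[/IH1|/IH2] ->; rewrite ?linear0l ?linear0r.
Qed.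

Fixpoint rename (s : nat -> nat) (m : na_mon) : na_mon :=
  match m with
  | NVar i => NVar (s i) | NMul m1 m2 => NMul (rename s m1) (rename s m2)
  end.

Lemma na_mon_eval_rename A (v : nat -> A) s m :
  na_mon_eval v (rename s m) = na_mon_eval (v \o s) m.
Proof. by elim: m => //= m1 -> m2 ->. Qed.

Lemma mon_vars_rename s m : mon_vars (rename s m) = map s (mon_vars m).
Proof. by elim: m => //= m1 -> m2 ->; rewrite map_cat. Qed.

Lemma na_deg_rename s m : na_deg (rename s m) = na_deg m.
Proof. by rewrite -!size_mon_vars mon_vars_rename size_map. Qed.

(** The bound [d] is on the depth, which keeps the recursion simple; a monomial of
    degree at most [d] has depth at most [d]. *)
Fixpoint small_mons (n d : nat) : seq na_mon :=
  if d is d'.+1 then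
    map NVar (iota 0 n)
    ++ [seq NMul m1 m2 | m1 <- small_mons n d', m2 <- small_mons n d']
  else [::].

Lemma mem_small_mons n d m : all (fun i => i < n)%N (mon_vars m) ->
  (na_deg m <= d)%N -> m \in small_mons n d.
Proof.
elim: d m => [|d IHd] m; first by rewrite leqNgt na_deg_gt0.
case: m => [i|m1 m2] /=; rewrite mem_cat.
  by rewrite andbT => lt_in _; rewrite map_f // mem_iota.
rewrite all_cat => /andP[v1 v2] deg12.
have := na_deg_gt0 m1; have := na_deg_gt0 m2 => d2 d1.
apply/orP; right; apply: allpairs_f; apply: IHd => //; lia.
Qed.

(** Gaussian elimination on the list [M], for a subspace that is only given as a
    predicate: a member with a nonzero coefficient at the head of [M], if there
    is one, is a generator and reduces the rest to the tail of [M]. *)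
Lemma supported_finite_basis (M : seq na_mon) (P : na_poly k -> Prop) :
    (forall c f g, P f -> P g -> P (f + c *: g)) ->
    (forall f, P f -> {subset msupp f <= M}) ->
  exists2 s : seq (na_poly k), forall f, f \in s -> P f &
    forall A, (forall f, f \in s -> satisfies A f) ->
    forall f, P f -> satisfies A f.
Proof.
elim: M P => [|m M IHM] P Plin PM.
  exists [::] => // A _ f /PM fM v; rewrite /na_poly_eval big_seq big1 // => m.
  by move/fM.
pose P' f := P f /\ f@_m = 0.
have [||s sP' sA] := IHM P'.
- by move=> c f g [Pf f0] [Pg g0]; split; [apply: Plin | rewrite mcoeffD mcoeffZ f0 g0 mulr0 addr0].
- move=> f [/PM fM f0] m' m'f; move: (fM _ m'f); rewrite inE => /predU1P[mm'|//].
  by move: m'f; rewrite -mcoeff_neq0 mm' f0 eqxx.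
have [[g [Pg gm]]|nog] := classic (exists g, P g /\ g@_m != 0).
  exists (g :: s) => [f|A As f Pf]; first by rewrite inE => /predU1P[->//|/sP'[]].
  pose c := f@_m / g@_m; have Ag : satisfies A g by apply: As; rewrite mem_head.
  have Afg : satisfies A (f + (- c) *: g).
    apply: sA => [h hs|]; first by apply: As; rewrite inE hs orbT.
    by split; [apply: Plin | rewrite mcoeffD mcoeffZ mulNr divfK // subrr].
  by move=> v; have := Afg v; rewrite na_poly_evalD na_poly_evalZ Ag scaler0 addr0.
exists s => [f /sP'[]//|A As f Pf]; apply: sA => //; split=> //.
by apply/eqP; apply: contra_notT nog => fm; exists f.
Qed.

End Identities.

(** * Restriction to few variables, and the finite basis *)

Section Support.
Variables (k : fieldType) (b : nat).
Implicit Types (A : na_alg k) (f : na_poly k) (K : {set 'I_b.+1}).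

Definition bounded_vars f := forall m i, m \in msupp f -> i \in mon_vars m -> (i <= b)%N.

(** The test [i <= b] matters, as [inord] sends all larger indices to 0. *)
Definition restrict A (v : nat -> A) K : nat -> A :=
  fun i => if (i <= b)%N && (inord i \in K) then v i else 0.

Definition var_set (m : na_mon) : {set 'I_b.+1} := [set i | val i \in mon_vars m].

Lemma card_var_set m : (#|var_set m| <= na_deg m)%N.
Proof.
rewrite -size_mon_vars cardE -(size_map val); apply: uniq_leq_size.
  by rewrite map_inj_uniq ?enum_uniq //; apply: val_inj.
by move=> _ /mapP[i + ->]; rewrite mem_enum inE.
Qed.

Lemma na_mon_eval_restrict A (v : nat -> A) K m :
  (forall i, i \in mon_vars m -> (i <= b)%N) ->
  na_mon_eval (restrict v K) m = if var_set m \subset K then na_mon_eval v m else 0.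
Proof.
move=> mb; case: ifPn => [/subsetP mK | /subsetPn[i im iK]].
  apply: eq_na_mon_eval => i im; rewrite /restrict mb // mK //.
  by rewrite inE /= inordK ?ltnS ?mb.
rewrite inE in im; apply: na_mon_eval_eq0 im _.
by rewrite /restrict inord_val (negPf iK) andbF.
Qed.

(** If [K] has at least [n] elements, a monomial of degree below [n] does not use
    all variables of [K], so the alternating sum over the subsets of [K] of the
    restrictions is zero; by induction only the term of [K] itself is left. *)
Lemma satisfies_small_support A f n : bounded_vars f ->
    (forall m (v : nat -> A), (n <= na_deg m)%N -> na_mon_eval v m = 0) ->
    (forall v K, (#|K| < n)%N -> na_poly_eval (restrict (A := A) v K) f = 0) ->
  satisfies A f.
Proof.
move=> fb longA smallA v.
have all0 K : na_poly_eval (restrict v K) f = 0.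
  have [d leKd] := ubnP #|K|; elim: d => // d IHd in K leKd *.
  have [/smallA//|leK] := ltnP #|K| n.
  have: \sum_(K' : {set 'I_b.+1} | K' \subset K)
      (-1) ^+ #|K'| *: na_poly_eval (restrict v K') f = 0.
    under eq_bigr do rewrite scaler_sumr; rewrite exchange_big big_seq big1 // => m mf.
    transitivity (f@_m *: (\sum_(K' : {set 'I_b.+1} | (var_set m \subset K') && (K' \subset K))
        (-1) ^+ #|K'| *: na_mon_eval v m)).
      rewrite scaler_sumr [LHS]big_mkcond [RHS]big_mkcond; apply: eq_bigr => K' _.
      rewrite (na_mon_eval_restrict _ _ (fun i => fb m i mf)) andbC.
      case: (K' \subset K); case: (var_set m \subset K'); rewrite /= ?scaler0 //.
      by rewrite !scalerA mulrC.
    rewrite -scaler_suml alternating_sum; case: eqP => [mK|_]; last by rewrite mul0r scale0r scaler0.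
    by rewrite longA ?scaler0 // (leq_trans leK) // -mK card_var_set.
  rewrite (bigD1 K) //= big1 ?addr0 => [/eqP|K' /andP[K'K neK]]; last first.
    by rewrite IHd ?scaler0 // -ltnS (leq_trans _ leKd) // ltnS proper_card // properEneq neK.
  by rewrite scaler_eq0 signr_eq0 => /eqP.
rewrite -[RHS](all0 setT); apply: eq_big_seq => m mf; congr (_ *: _).
by rewrite (na_mon_eval_restrict _ _ (fun i => fb m i mf)) subsetT.
Qed.

(** The part of [f] in the variables of [K] and in degree below [n], with these
    variables renamed to the first natural numbers.  [small_mons] then contains
    its support whatever the number of variables of [f] was. *)
Definition compress f K n : na_poly k :=
  \sum_(m <- msupp f | (var_set m \subset K) && (na_deg m < n)%N)
    << f@_m *g rename (fun i => index (inord i) (enum K)) m >>.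

Lemma compress_eval A f K n (v w : nat -> A) :
    bounded_vars f ->
    (forall m (v : nat -> A), (n <= na_deg m)%N -> na_mon_eval v m = 0) ->
    (forall i, i \in K -> v (val i) = w (index i (enum K))) ->
  na_poly_eval w (compress f K n) = na_poly_eval (restrict v K) f.
Proof.
move=> fb longA vw; rewrite na_poly_eval_sum big_mkcond; apply: eq_big_seq => m mf.
rewrite (na_mon_eval_restrict _ _ (fun i => fb m i mf)).
case: (var_set m \subset K) (@subsetP _ (var_set m) K) => [/(_ isT) mK|_] /=; last by rewrite scaler0.
case: ltnP => [_|/longA->]; last by rewrite scaler0.
rewrite na_poly_evalU na_mon_eval_rename; congr (_ *: _).
apply: eq_na_mon_eval => i im /=; have ib := fb _ _ mf im.
have iK : (inord i : 'I_b.+1) \in K by apply: mK; rewrite inE /= inordK.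
by rewrite -vw /= ?inordK.
Qed.

Lemma compress_supported f K n : (#|K| < n)%N ->
  {subset msupp (compress f K n) <= small_mons n n}.
Proof.
move=> Kn m; apply: contraLR => mnin; rewrite -mcoeff_eq0 raddf_sum big1 //= => m' /andP[m'K degm'].
rewrite mcoeffU; case: eqP => [m'm|]; last by rewrite mulr0n.
case/negP: mnin; rewrite -m'm; apply: mem_small_mons.
  rewrite mon_vars_rename all_map; apply/allP => i im /=.
  apply: leq_trans Kn; rewrite ltnS cardE; exact: index_size.
by rewrite na_deg_rename ltnW.
Qed.

End Support.

Theorem corollary2 (k : fieldType) (hk : [pchar k]%R =i pred0) :
  spechtian (@dual_leibniz k).
Proof.
split.
  exists (fun f => f = dual_leibniz_poly k) => A.
  by split=> [/dual_leibniz_polyP zA f ->//|/(_ _ erefl)/dual_leibniz_polyP].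
move=> W [[S WS] Wzin].
(* If all normal forms are zero, [W] is the variety of all dual Leibniz algebras. *)
have [[f [Sf [w fw]]]|trivS] := classic (exists f, S f /\ exists w, nf_coef f w != 0); last first.
  exists [:: dual_leibniz_poly k] => A; split=> [WA f|/(_ _ (mem_head _ _))/dual_leibniz_polyP zA].
    by rewrite inE => /eqP->; apply/dual_leibniz_polyP/Wzin.
  apply/WS => f Sf v; rewrite na_poly_eval_nf // big1 // => w _.
  have [->|fw] := eqVneq (nf_coef f w) 0; first by rewrite scale0r.
  by case: trivS; exists f; split=> //; exists w.
have [n nilW] := identity_nil hk fw.
pose N := nilpotency_bound n.
have nilpW A : W A -> nilpotent_at A N.
  move=> WA s t szs; have zA := Wzin _ WA.
  have starA : forall x : A, starpow x n.+1 = 0 by exact: (nilW A zA ((WS A).1 WA f Sf)).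
  apply: (@nil_nilpotent k A zA n (fun=> True) (fun x => x = 0)) => //.
  - split=> [x y -> ->|c x _ ->]; first by rewrite subrr.
    by rewrite linear0l linear0r.
  - by move=> r szr _; apply: starprod_linearize szr.
  by elim: (s) => //=.
have longE (A : na_alg k) : dual_leibniz A -> nilpotent_at A N ->
    forall m (v : nat -> A), (N.+1 <= na_deg m)%N -> na_mon_eval v m = 0.
  by move=> zA nA m v; apply: nilpotent_na_mon_eval.
pose P (g : na_poly k) :=
  {subset msupp g <= small_mons N.+1 N.+1} /\ forall A, W A -> satisfies A g.
have [||s sP sA] := @supported_finite_basis k (small_mons N.+1 N.+1) P.
- move=> c g h [gM gW] [hM hW]; split=> [m|A WA v].
    move=> /(fsubsetP (msuppD_le _ _)); rewrite inE => /orP[/gM//|].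
    by move=> /(fsubsetP (msuppZ_le _ _))/hM.
  by rewrite na_poly_evalD na_poly_evalZ gW // hW // scaler0 addr0.
- by move=> g [].
exists [:: dual_leibniz_poly k, << long_word N >> & s] => A; split=> [WA g|As].
  rewrite !inE => /or3P[/eqP->|/eqP->|/sP[_ gW]]; last exact: gW.
    exact/dual_leibniz_polyP/Wzin.
  exact/nilpotent_atP/nilpW.
have zA : dual_leibniz A by apply/dual_leibniz_polyP/As; rewrite !inE eqxx.
have nA : nilpotent_at A N by apply/nilpotent_atP/As; rewrite !inE eqxx orbT.
apply/WS => g Sg.
pose b := (\max_(m <- msupp g) \max_(i <- mon_vars m) i)%N.
have gb : bounded_vars b g.
  move=> m i mg im; apply: (@leq_trans (\max_(j <- mon_vars m) j)%N).
    exact: (leq_bigmax_seq (F := id) i im isT).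
  exact: (leq_bigmax_seq (F := fun m => \max_(i <- mon_vars m) i)%N m mg isT).
(* The restriction of [g] to [K] is up to renaming an identity of [W] with small
   support, hence a consequence of [s]. *)
refine (@satisfies_small_support k b A g N.+1 gb (longE A zA nA) _) => v K Kn.
pose e i := v (val (nth ord0 (enum K) i)).
rewrite -(@compress_eval k b A g K N.+1 v e gb (longE A zA nA)); last first.
  by move=> i iK; rewrite /e nth_index ?mem_enum.
have As' h : h \in s -> satisfies A h.
  by move=> hs; apply: (As h); apply: mem_behead; apply: mem_behead.
refine (sA A As' _ _ e); split=> [|B WB u]; first exact: compress_supported.
pose u' i := u (index (inord i : 'I_b.+1) (enum K)).
rewrite (@compress_eval k b B g K N.+1 u' u gb (longE B (Wzin _ WB) (nilpW _ WB))).
  by apply: (proj1 (WS B) WB).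
by move=> i iK; rewrite /u' inord_val.
Qed.
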